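(* Let $X$ be a random vector with values in a real separable F-space $B$, with law $\mu$, and let $t_k: B\to\mathbb{R}$, $k\ge 1$, be Borel measurable functionals. Assume that $\{t_k(X): k\ge 1\}$ are mean zero random variables with variances $\sigma_k^2\in(0,\infty)$, $k\ge 1$, and that $\mathbb{E}(t_i(X)t_j(X))=0$ for all $1\le i<j<\infty$. Let $\mathcal{T}$ consist of all finite linear combinations of the maps $\{t_k: k\ge 1\}$. Then $$HD_{\mathcal{T}}(a,\mu)=0$$ for all $a\in B$ such that $$\sum_{k\ge 1}\frac{t_k^2(a)}{\sigma_k^2}=\infty.$$ Furthermore, $HD_{\mathcal{T}}(a,\mu)=0$ holds for $\mu$-almost every $a\in B$ if $$P\Big(\sum_{k\ge 1} t_k^2(X)/\sigma_k^2=\infty\Big)=1.$$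
   Context: A real separable F-space is a real topological vector space whose topology is induced by a complete, separable, translation invariant metric; it carries its Borel sigma-field. $X$ is defined on a probability space $(\Omega,\mathcal{F},P)$, is Borel measurable, and $\mu=\mathcal{L}(X)$. For a collection $\mathcal{T}$ of Borel measurable functionals on $B$ and $a\in B$, the half space depth of $a$ with respect to $\mathcal{T}$ and $\mu$ is $$HD_{\mathcal{T}}(a,\mu)=\inf_{t\in\mathcal{T}}P(t(X)\ge t(a))=\inf_{t\in\mathcal{T}}\mu(x\in B: t(x)\ge t(a)).$$ The functionals are not assumed linear or continuous. *)

(* Defs.v *)
From HB Require Import structures.
From mathcomp Require Import all_boot all_order all_algebra.
From mathcomp Require Import all_classical all_reals all_analysis.

Set Implicit Arguments.
Unset Strict Implicit.
Unset Printing Implicit Defensive.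

Import Order.TTheory GRing.Theory Num.Theory.
Import numFieldNormedType.Exports.

Local Open Scope classical_set_scope.
Local Open Scope ring_scope.

(* [d] is required to induce the given topology of [B]. A structure joining
   [Metric] and [TopologicalLmodule] is rejected by HB: it would have to be
   declared before [PseudoMetricNormedZmod]. *)
Record separable_fspace_metric (R : realType) (B : topologicalLmodType R)
    (d : B -> B -> R) : Prop := {
  fdist_ge0 : forall x y, 0 <= d x y ;
  fdist_eq0 : forall x y, d x y = 0 <-> x = y ;
  fdist_sym : forall x y, d x y = d y x ;
  fdist_triangle : forall x y z, d x z <= d x y + d y z ;
  fdist_translation : forall x y z, d (x + z) (y + z) = d x y ;
  fdist_nbhs : forall x : B,
    nbhs x = filter_from [set e : R | 0 < e] (fun e => [set y | d x y < e]) ;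
  fdist_complete : forall u : nat -> B,
    (forall e : R, 0 < e -> exists N : nat, forall m n : nat,
       (N <= m)%N -> (N <= n)%N -> d (u m) (u n) < e) ->
    exists l : B, u @ \oo --> l ;
  fdist_separable : exists2 D : set B, countable D & dense D
}.

(* Not based on [tvsType], which requires local convexity. *)
Definition separable_fspace (R : realType) (B : topologicalLmodType R) : Prop :=
  exists d : B -> B -> R, separable_fspace_metric d.

(* [g_sigma_algebraType] would need a [pointedType]; the point is taken to
   be 0. *)
Definition borel (B : topologicalZmodType) : Type := B.
HB.instance Definition _ (B : topologicalZmodType) := Choice.on (borel B).
HB.instance Definition _ (B : topologicalZmodType) :=
  isPointed.Build (borel B) (0 : B).
HB.instance Definition _ (B : topologicalZmodType) :=
  @isMeasurable.Build (sigma_display (@open B)) (borel B) <<s @open B >>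
    (@sigma_algebra0 _ setT _) (@sigma_algebraC (borel B) (@open B))
    (@sigma_algebra_bigcup _ setT _).

Section half_space_depth.
Context d (S : measurableType d) (R : realType).

Definition half_space_depth (T : set {mfun S >-> R}) (a : S)
    (mu : probability S R) : \bar R :=
  ereal_inf [set mu [set x | t a <= t x] | t in T].

(* Repeated indices in [s] are harmless: the coefficients add up. *)
Definition linear_combinations (t : nat -> {mfun S >-> R}) :
    set {mfun S >-> R} :=
  [set f | exists (s : seq nat) (c : nat -> R),
     forall x, f x = \sum_(i <- s) c i * t i x].

End half_space_depth.

(* Main.v *)
(** For [c_k = t_k(a) / sigma_k^2] the functional [f_n = sum_(k < n) c_k t_k]
    satisfies [f_n(a) = Var f_n(X) = s_n], the [n]-th partial sum of
    [sum_k t_k(a)^2 / sigma_k^2]. By Chebyshev,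
    [P(f_n(X) >= f_n(a)) <= s_n / s_n^2 = 1 / s_n], which tends to 0 when the
    series diverges. *)
Require Import Defs.
From HB Require Import structures.
From mathcomp Require Import all_boot all_order all_algebra.
From mathcomp Require Import all_classical all_reals all_analysis.
From mathcomp Require Import measurable_realfun ring.

Set Implicit Arguments.
Unset Strict Implicit.
Unset Printing Implicit Defensive.

Import Order.TTheory GRing.Theory Num.Theory.
Import numFieldNormedType.Exports.

Local Open Scope classical_set_scope.
Local Open Scope ring_scope.
Local Open Scope ereal_scope.

Section uncorrelated_sums.
Context d (T : measurableType d) (R : realType) (P : probability T R).

(** The integral of [(f - m)^2], with [m] the real part of the mean, is the variance itself, so
    [f - m] is square integrable; adding back the constant [m] stays in L2 because [P] is finite.
    Since [m] is defined through [fine], it is real in all cases. *)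
Lemma variance_lty_Lfun2 (f : {mfun T >-> R}) :
  'V_P[f] < +oo -> (f : T -> R) \in Lfun P 2%:E.
Proof.
rewrite /variance unlock; set m := fine _; rewrite unlock => fm_lty.
have fmL2 : (f \- cst m : T -> R)%R \in Lfun P 2%:E.
  rewrite inE; apply/andP; split; first by rewrite inE/=; exact: measurable_funB.
  rewrite inE/= /finite_norm [in ltLHS]unlock poweR_lty//.
  apply: le_lt_trans fm_lty; apply: ge0_le_integral => //.
  - by move=> x _; exact: poweR_ge0.
  - apply/measurable_EFinP.
    apply: (@measurableT_comp _ _ _ _ _ _ (fun x : R => x `^ 2)%R) => //.
    by apply: measurableT_comp => //; exact: measurable_funB.
  - apply/measurable_EFinP; apply: measurable_funM; exact: measurable_funB.
  - move=> x _ /=; rewrite lee_fin powR_mulrn// -expr2 real_normK//.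
    exact: num_real.
have -> : (f : T -> R) = ((f \- cst m) + cst m)%R.
  by apply/funext => x; rewrite /GRing.add /= subrK.
by apply: rpredD => [|p1|p1]; [rewrite lee1n|exact: fmL2|exact: Lfun_cst].
Qed.

Context (Y : nat -> T -> R) (YL2 : forall i, Y i \in Lfun P 2%:E).
Context (Y0 : forall i, 'E_P[Y i] = 0).
Context (YY : forall i j, (i < j)%N -> covariance P (Y i) (Y j) = 0).
Context (c : nat -> R).

Local Notation S n := (\sum_(i < n) c i \o* Y i : T -> R)%R.

Lemma Lfun2_lin_comb n : S n \in Lfun P 2%:E.
Proof.
apply: rpred_sum => [|p1 i _]; first by rewrite lee1n.
by apply: Lfun_scale; rewrite ?ler1n.
Qed.

Let Lfun21 (f : T -> R) : f \in Lfun P 2%:E -> f \in Lfun P 1.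
Proof. by apply: Lfun_subset12; exact: fin_num_measure. Qed.

Let SS n : S n.+1 = (S n \+ c n \o* Y n)%R.
Proof. by rewrite big_ord_recr. Qed.

Let S0 : S 0 = cst 0%R.
Proof. by rewrite big_ord0. Qed.

Let cYL2 n : (c n \o* Y n)%R \in Lfun P 2%:E.
Proof. by apply: Lfun_scale; rewrite ?ler1n. Qed.

Lemma expectation_lin_comb0 n : 'E_P[S n] = 0.
Proof.
elim: n => [|n IHn]; first by rewrite S0 expectation_cst.
rewrite SS expectationD ?Lfun21 ?Lfun2_lin_comb//.
by rewrite IHn expectationZl ?Lfun21// Y0 mule0 adde0.
Qed.

(** [S n] involves only indices below [n], hence below [m], so [YY] kills each term. The case
    [m = n] removes the cross term in the variance recursion. *)
Lemma covariance_lin_comb0 n m : (n <= m)%N -> covariance P (S n) (Y m) = 0.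
Proof.
elim: n => [|n IHn] nm; first by rewrite S0 covariance_cst_l.
rewrite SS covarianceDl ?Lfun2_lin_comb// IHn 1?ltnW//.
by rewrite covarianceZl ?Lfun2_mul_Lfun1 ?Lfun21// YY// mule0 adde0.
Qed.

Lemma variance_lin_comb n :
  'V_P[S n] = \sum_(i < n) (c i ^+ 2)%:E * 'V_P[Y i].
Proof.
elim: n => [|n IHn]; first by rewrite S0 variance_cst big_ord0.
rewrite SS varianceD ?Lfun2_lin_comb// big_ord_recr/= IHn varianceZ//.
rewrite covarianceZr ?Lfun2_mul_Lfun1 ?Lfun21 ?Lfun2_lin_comb//.
by rewrite covariance_lin_comb0// !mule0 adde0.
Qed.

End uncorrelated_sums.

Lemma half_space_depth_ge0 d (S : measurableType d) (R : realType)
  (F : set {mfun S >-> R}) (a : S) (mu : probability S R) :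
  0 <= half_space_depth F a mu.
Proof. by apply: le_ereal_inf_tmp => _ [t _ <-]; exact: measure_ge0. Qed.

(** If [M] bounded every partial sum it would also bound their limit, which exists by
    nonnegativity. *)
Lemma nneseries_pinfty_gt (R : realType) (u : nat -> R) (M : R) :
  (forall n, 0 <= u n)%R -> \sum_(0 <= k <oo) (u k)%:E = +oo ->
  exists n, (M < \sum_(i < n) u i)%R.
Proof.
move=> u0 uoo; apply: contrapT => /forallNP uM.
suff : \sum_(0 <= k <oo) (u k)%:E <= M%:E by rewrite uoo leye_eq.
apply: lime_le; first by apply: is_cvg_nneseries => n _ _; rewrite lee_fin.
apply: nearW => n; rewrite big_mkord sumEFin lee_fin leNgt.
exact/negP/uM.
Qed.

Theorem theorem1 (R : realType) (B : topologicalLmodType R)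
  (B_fspace : separable_fspace B)
  (d : measure_display) (Omega : measurableType d) (P : probability Omega R)
  (X : {RV P >-> borel B})
  (t : nat -> {mfun borel B >-> R})
  (sigma : nat -> R)
  (t_integrable : forall k, (t k \o X : Omega -> R) \in Lfun P 1)
  (t_mean0 : forall k, 'E_P[t k \o X] = 0)
  (sigma2_gt0 : forall k, (0 < sigma k ^+ 2)%R)
  (t_variance : forall k, 'V_P[t k \o X] = (sigma k ^+ 2)%:E)
  (t_orthogonal : forall i j, (i < j)%N ->
    'E_P[(t i \o X) \* (t j \o X)] = 0) :
  (forall a : borel B,
     \sum_(0 <= k <oo) ((t k a) ^+ 2 / sigma k ^+ 2)%:E = +oo ->
     half_space_depth (linear_combinations t) a (distribution P X) = 0)
  /\
  (P [set w | \sum_(0 <= k <oo) ((t k (X w)) ^+ 2 / sigma k ^+ 2)%:E = +oo] = 1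
   -> {ae distribution P X, forall a : borel B,
        half_space_depth (linear_combinations t) a (distribution P X) = 0}).
Proof.
pose Y k : Omega -> R := t k \o X.
have Y1 k : Y k \in Lfun P 1 by exact: t_integrable.
have YL2 k : Y k \in Lfun P 2%:E.
  by apply: variance_lty_Lfun2; rewrite t_variance ltry.
(* With zero means, the covariance is the expectation of the product. *)
have YY i j : (i < j)%N -> covariance P (Y i) (Y j) = 0.
  move=> ij; rewrite covarianceE ?Lfun2_mul_Lfun1// !t_mean0 mule0 sube0.
  exact: t_orthogonal.
pose u a k : R := (t k a ^+ 2 / sigma k ^+ 2)%R.
have u0 a k : (0 <= u a k)%R by rewrite divr_ge0 ?sqr_ge0.
have depth0 (a : borel B) : \sum_(0 <= k <oo) (u a k)%:E = +oo ->
    half_space_depth (linear_combinations t) a (distribution P X) = 0.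
  move=> uoo; apply/eqP; rewrite eq_le half_space_depth_ge0 andbT.
  apply/lee_addgt0Pr => e e0; rewrite add0e.
  (* The Chebyshev bound will be [s^-1], so a partial sum beyond [e^-1] brings it below [e]. *)
  have [n nu] := nneseries_pinfty_gt e^-1 (u0 a) uoo.
  pose s := (\sum_(i < n) u a i)%R.
  have s0 : (0 < s)%R by apply: lt_trans nu; rewrite invr_gt0.
  pose c k := (t k a / sigma k ^+ 2)%R.
  (* Ring operations on measurable functions, with constants as factors, make [f] measurable by
     construction. *)
  pose f : {mfun borel B >-> R} := (\sum_(i < n) t i * cst (c i))%R.
  have fE x : f x = (\sum_(i < n) t i x * c i)%R by rewrite mfun_sum.
  have fa : f a = s.
    by rewrite fE; apply: eq_bigr => i _; rewrite /c /u mulrA expr2.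
  have fXE : (f \o X : Omega -> R) = (\sum_(i < n) c i \o* Y i)%R.
    by apply/funext => w; rewrite /= fE fct_sumE.
  (* The infimum is at most its value at the single functional [f], a combination over the index
     list [iota 0 n]. *)
  apply: (@le_trans _ _ (distribution P X [set x | (f a <= f x)%R])).
    apply: ereal_inf_lbound; exists f => //; exists (iota 0 n), c => x.
    rewrite fE -(big_mkord xpredT (fun i => t i x * c i)%R) /index_iota subn0.
    by apply: eq_bigr => i _; rewrite mulrC.
  have EfX : 'E_P[f \o X] = 0 by rewrite fXE; exact: expectation_lin_comb0.
  have VfX : 'V_P[f \o X] = s%:E.
    rewrite fXE variance_lin_comb// /s -sumEFin; apply: eq_bigr => i _.
    rewrite t_variance -EFinM /c /u; congr EFin; field.
    by rewrite -sqrf_eq0 gt_eqF.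
  have := chebyshev (P := P) (f \o X) s0; rewrite EfX VfX.
  rewrite -EFinM => cheb.
  rewrite /distribution /pushforward.
  (* As [f a = s] and [f \o X] has mean 0, the half space event lies inside the two-sided deviation
     event that Chebyshev controls. *)
  apply: (@le_trans _ _ (P [set w | (s <= `|(f \o X) w - fine 0%:E|)%R])).
    apply: (le_measure P); rewrite ?inE.
    - rewrite [X in measurable X](_ : _ = (f \o X) @^-1` `[f a, +oo[%classic).
        by apply: measurable_funPTI.
      by apply/seteqP; split=> w /=; rewrite in_itv/= andbT.
    - rewrite [X in measurable X](_ : _ =
          ((fun w => `|(f \o X) w|)%R : Omega -> R) @^-1` `[s, +oo[%classic).
        by rewrite -[_ @^-1` _]setTI; apply: measurableT_comp.
      by apply/seteqP; split=> w /=; rewrite in_itv/= andbT subr0.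
    - move=> w /=; rewrite fa subr0 => /le_trans; apply; exact: ler_norm.
  apply: le_trans cheb _; rewrite lee_fin.
  rewrite (_ : s ^- 2 * s = s^-1)%R; last by field; rewrite gt_eqF.
  by rewrite invf_ple// ?posrE// ltW.
split=> [//|Poo].
pose A := [set a : borel B | \sum_(0 <= k <oo) (u a k)%:E = +oo].
(* A series of nonnegative measurable functions is measurable, hence so is the set where it equals
   [+oo]. *)
have mA : measurable A.
  rewrite -[A]setTI; apply: measurable_eqe => //.
  apply: (ge0_emeasurable_sum (P := xpredT)) => [k x _ _|k _].
    by rewrite lee_fin.
  apply/measurable_EFinP; apply: measurable_funM => //.
  exact: measurable_funX.
(* The exceptional set lies in the complement of [A], which is null: the law of [X] gives [A] the
   probability in [Poo], namely 1. *)
exists (~` A); split; first exact: measurableC.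
  by rewrite probability_setC// [Z in 1 - Z]Poo subee.
by move=> a /= na Aa; apply: na; exact: depth0.
Qed.
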